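(* Let $G=(V,E)$ be a simple undirected graph with $V=\{1,\dots,n\}$ and let $V_I,V_O\subseteq V$. If $V_I\cap V_O$ is a zero forcing set in $G$, then $(G;V_I;V_O)$ is identifiable.
   Context: All graphs are simple (no self-loops, at most one edge between any pair of vertices) and undirected, with vertex set $V=\{1,\dots,n\}$. A vertex $j$ is a neighbour of $i$ if $(i,j)\in E$. Matrix class. $\mathcal{Q}_p(G)$ is the set of real symmetric $n\times n$ matrices $X$ such that for all $i\neq j$: $X_{ji}>0$ if $(i,j)\in E$, and $X_{ji}=0$ if $(i,j)\notin E$. The diagonal entries of $X$ are arbitrary real numbers. Input/output matrices. For $V'=\{v_1,\dots,v_r\}\subseteq V$, $P(V;V')$ is the $n\times r$ matrix with $P_{ij}=1$ if $i=v_j$ and $P_{ij}=0$ otherwise. Given input nodes $V_I\subseteq V$ and output nodes $V_O\subseteq V$, put $M=P(V;V_I)$ and $N=P(V;V_O)^\top$. Identifiability. $(G;V_I;V_O)$ is identifiable if for all $X,\bar X\in\mathcal{Q}_p(G)$: whenever $N(sI-X)^{-1}M=N(sI-\bar X)^{-1}M$ (as rational matrices in the complex variable $s$), then $X=\bar X$. Zero forcing. Vertices of $G$ are colored black or white. Color-change rule: if $u$ is a black vertex and exactly one neighbour $v$ of $u$ is white, then change the color of $v$ to black. For $Z\subseteq V$, color the vertices of $Z$ black and those of $V\setminus Z$ white; the derived set $D(Z)$ is the set of black vertices obtained by applying the color-change rule until no more changes are possible. $Z$ is a zero forcing set in $G$ if $D(Z)=V$. *)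

(* Defs.v *)
From HB Require Import structures.
From mathcomp Require Import all_boot all_order all_algebra fraction.
From mathcomp Require Import complex reals.

Set Implicit Arguments.
Unset Strict Implicit.
Unset Printing Implicit Defensive.

Import GRing.Theory Num.Theory.
Local Open Scope ring_scope.
Local Open Scope complex_scope.

Local Notation "x %:F" := (tofrac x) : ring_scope.

(* A graph on {1, ..., n} is an adjacency relation on 'I_n; it is simple and
   undirected when the relation is irreflexive and symmetric. *)
Definition simple_graph (n : nat) (e : rel 'I_n) : Prop :=
  irreflexive e /\ symmetric e.

Section ZeroForcing.
Context {n : nat}.
Implicit Types (e : rel 'I_n) (Z B D : {set 'I_n}).

(* Sets are the sets of black vertices; one application of the rule recolors
   one vertex, so every color change strictly enlarges the black set. *)
Definition color_change e : rel {set 'I_n} := fun B B' =>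
  [exists u in B, exists v,
    ([set w | e u w & w \notin B] == [set v]) && (B' == v |: B)].

Definition derived_set e Z D : Prop :=
  connect (color_change e) Z D /\ forall B, ~~ color_change e D B.

Definition zero_forcing e Z : Prop := derived_set e Z [set: 'I_n].

Lemma color_change_proper e B B' : color_change e B B' -> B \proper B'.
Proof.
case/exists_inP=> u uB /existsP[v /andP[/eqP Ev /eqP->]].
have : v \in [set v] by rewrite inE.
by rewrite -{1}Ev inE => /andP[_ vB]; apply: properUr; rewrite sub1set.
Qed.

Lemma color_change_sub e Z B D :
  Z \subset D -> (forall B', ~~ color_change e D B') ->
  connect (color_change e) Z B -> B \subset D.
Proof.
move=> ZD stuck /connectP[p]; elim: p Z ZD => [|A p IHp] Z ZD /=.
  by move=> _ ->.
case/andP=> ZA; apply: IHp.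
case/exists_inP: ZA => u uZ /existsP[v /andP[/eqP Ev /eqP->]].
rewrite subUset ZD andbT sub1set; apply/negPn/negP => vD.
case/negP: (stuck (v |: D)).
apply/exists_inP; exists u; first exact: (subsetP ZD).
apply/existsP; exists v; rewrite eqxx andbT; apply/eqP/setP=> w.
have /setP/(_ w) := Ev; rewrite !inE.
have [-> |_] := eqVneq w v; first by rewrite vD => /andP[->].
case: (e u w) => //= /negbFE wZ.
by rewrite (subsetP ZD).
Qed.

(* Hence [derived_set e Z] is the graph of a function of Z. *)
Lemma derived_set_unique e Z : exists! D, derived_set e Z D.
Proof.
have [D ZD stuck] : exists2 D, connect (color_change e) Z D &
    forall B, ~~ color_change e D B.
  have [m] := ubnP (#|~: Z|); elim: m Z => // m IHm Z leZm.
  case: (boolP [exists B, color_change e Z B]) => [/existsP[B ZB]|].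
    have [|D BD stuck] := IHm B.
      apply: leq_trans (_ : #|~: Z| <= m)%N; last by rewrite -ltnS.
      by apply: proper_card; rewrite properC (color_change_proper ZB).
    by exists D => //; apply: connect_trans BD; apply: connect1.
  rewrite negb_exists => /forallP stuck.
  by exists Z.
have inc A : connect (color_change e) Z A -> Z \subset A.
  case/connectP=> p; elim: p Z {ZD} => [|B p IHp] Z /=; first by move=> _ ->.
  case/andP=> /color_change_proper/proper_sub ZB pB lA.
  exact: subset_trans ZB (IHp _ pB lA).
exists D; split=> // D' [ZD' stuck'].
apply/eqP; rewrite eqEsubset; apply/andP; split.
  exact: color_change_sub (inc _ ZD') stuck' ZD.
exact: color_change_sub (inc _ ZD) stuck ZD'.
Qed.

End ZeroForcing.

Section Identifiability.
Context {R : realType} {n : nat}.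
Implicit Types (e : rel 'I_n) (X : 'M[R]_n) (VI VO : {set 'I_n}).

Definition Qp e X : Prop :=
  X^T = X /\
  forall i j, i != j ->
    (e i j -> 0 < X j i) /\ (~~ e i j -> X j i = 0).

(* The field C(s) of rational functions in the complex variable s; the
   variable s itself is the image of the polynomial 'X. *)
Local Notation "'Cs'" := {fraction {poly R[i]}}.

(* v_j is [enum_val j], the j-th element of V' in increasing order. *)
Definition selection (V' : {set 'I_n}) : 'M[Cs]_(n, #|V'|) :=
  \matrix_(i, j) (i == enum_val j)%:R.

Definition resolvent_pencil X : 'M[Cs]_n :=
  ('X%:F)%:M - map_mx (fun x : R => (x%:C)%:P%:F) X.

(* [invmx] is a total function; here it is a genuine inverse. *)
Lemma resolvent_pencil_unit X : resolvent_pencil X \in unitmx.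
Proof.
have -> : resolvent_pencil X =
    map_mx (@tofrac _) (char_poly_mx (map_mx (real_complex R) X)).
  by apply/matrixP=> i j; rewrite !mxE rmorphB rmorphMn.
rewrite unitmxE det_map_mx unitfE tofrac_eq0.
exact: monic_neq0 (char_poly_monic _).
Qed.

Definition transfer_matrix VI VO X : 'M[Cs]_(#|VO|, #|VI|) :=
  (selection VO)^T *m invmx (resolvent_pencil X) *m selection VI.

End Identifiability.

Definition identifiable (R : realType) (n : nat) (e : rel 'I_n)
    (VI VO : {set 'I_n}) : Prop :=
  forall X Xbar : 'M[R]_n, Qp e X -> Qp e Xbar ->
    transfer_matrix VI VO X = transfer_matrix VI VO Xbar -> X = Xbar.

(* Main.v *)
(** The hypothesis says that the Markov parameters [(X ^+ k) a b] are known for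
    all [a], [b] in [VI :&: VO].  This property of a set [B] survives a color
    change forcing [v] from [u]: the row [u] of [X] is supported on [v |: B], so
    [X u v * (X ^+ k) v w] is known when [(X ^+ k.+1) u w] and the
    [(X ^+ k) j w], [j \in B], are.  With [k = 1] and [w = u] this gives
    [X u v ^+ 2], hence [X u v] by positivity, hence the row [v] of [X ^+ k].
    At [B = V] and [k = 1] one reads off [X]. *)
From HB Require Import structures.
Require Import Defs.
From mathcomp Require Import all_boot all_order all_algebra fraction.
From mathcomp Require Import complex reals.

Set Implicit Arguments.
Unset Strict Implicit.
Unset Printing Implicit Defensive.

Import Order.TTheory GRing.Theory Num.Theory.
Local Open Scope ring_scope.

Local Notation "x %:F" := (tofrac x) : ring_scope.

(** * Strictly proper rational fractions *)

Section StrictlyProper.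
Context {K : fieldType}.
Implicit Types (x y : {fraction {poly K}}) (c : K) (p q : {poly K}).

Definition strictly_proper x : Prop :=
  exists p q, x = p%:F / q%:F /\ (size p < size q)%N.

Lemma strictly_proper_den p q : (size p < size q)%N -> q != 0.
Proof. by move=> lt_pq; rewrite -size_poly_gt0 (leq_ltn_trans _ lt_pq). Qed.

Lemma strictly_proper0 : strictly_proper 0.
Proof.
by exists 0, 1; rewrite size_poly0 size_poly1 tofrac0 mul0r.
Qed.

Lemma strictly_properZ c x : strictly_proper x -> strictly_proper (c%:P%:F * x).
Proof.
case=> p [q [-> lt_pq]]; exists (c *: p), q; split.
  by rewrite -mul_polyC tofracM mulrA.
exact: leq_ltn_trans (size_scale_leq _ _) lt_pq.
Qed.

Lemma strictly_properD x y :
  strictly_proper x -> strictly_proper y -> strictly_proper (x + y).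
Proof.
case=> p1 [q1 [-> lt1]] [p2 [q2 [-> lt2]]].
have q1_neq0 := strictly_proper_den lt1.
have q2_neq0 := strictly_proper_den lt2.
exists (p1 * q2 + p2 * q1), (q1 * q2); split.
  by rewrite addf_div ?tofrac_eq0 // tofracD !tofracM.
have lt_mul (p q r : {poly K}) : (size p < size q)%N -> r != 0 ->
    (size (p * r)%R < size (q * r)%R)%N.
  move=> lt_pq r_neq0; have q_neq0 := strictly_proper_den lt_pq.
  have [->|p_neq0] := eqVneq p 0.
    by rewrite mul0r size_poly0 size_poly_gt0 mulf_neq0.
  rewrite !size_mul //; move: r_neq0; rewrite -size_poly_gt0.
  by case: (size r) => // m _; rewrite !addnS /= ltn_add2r.
apply: leq_ltn_trans (size_polyD _ _) _; rewrite gtn_max lt_mul //=.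
by rewrite [q1 * q2]mulrC lt_mul.
Qed.

Lemma strictly_proper_sum (I : finType) (F : I -> {fraction {poly K}}) :
  (forall i, strictly_proper (F i)) -> strictly_proper (\sum_i F i).
Proof.
move=> F_sp; apply: big_ind => // [|x y]; first exact: strictly_proper0.
exact: strictly_properD.
Qed.

Lemma strictly_properN x : strictly_proper x -> strictly_proper (- x).
Proof.
move=> /(strictly_properZ (-1)).
by rewrite polyCN polyC1 tofracN tofrac1 mulN1r.
Qed.

(** Clearing the denominator gives [c *: q = p], and scaling by a nonzero [c] preserves the size. So
    a constant can be separated from a strictly proper remainder. *)
Lemma strictly_proper_const c : strictly_proper (c%:P%:F) -> c = 0.
Proof.
case=> p [q [Ec lt_pq]]; have q_neq0 := strictly_proper_den lt_pq.
apply/eqP; apply/negPn/negP => c_neq0.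
have : (c%:P * q)%:F = p%:F.
  by rewrite tofracM Ec divfK // tofrac_eq0.
move/eqP; rewrite tofrac_eq mul_polyC => /eqP Ep.
by move: lt_pq; rewrite -Ep size_scale // ltnn.
Qed.

End StrictlyProper.

(** * Resolvents and their Markov parameters *)

Definition pencil (K : fieldType) (n : nat) (A : 'M[K]_n) :
  'M[{fraction {poly K}}]_n := map_mx (@tofrac _) (char_poly_mx A).

(* Locked because unification otherwise compares the resolvents of distinct
   matrices by unfolding [invmx]. *)
HB.lock Definition resolvent (K : fieldType) (n : nat) (A : 'M[K]_n) :
  'M[{fraction {poly K}}]_n := invmx (pencil A).

Section MarkovParameters.
Context {K : fieldType} {n : nat}.
Implicit Types A B : 'M[K]_n.

Definition const_frac_mx A : 'M[{fraction {poly K}}]_n :=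
  map_mx (fun c => c%:P%:F) A.

Lemma pencil_unit A : pencil A \in unitmx.
Proof.
rewrite unitmxE det_map_mx unitfE tofrac_eq0.
exact: monic_neq0 (char_poly_monic _).
Qed.

Lemma pencil_mul_resolvent A : pencil A *m resolvent A = 1%:M.
Proof. by rewrite unlock; apply: mulmxV (pencil_unit A). Qed.

Lemma pencilE A : pencil A = ('X%:F)%:M - const_frac_mx A.
Proof. by apply/matrixP=> i j; rewrite !mxE rmorphB rmorphMn. Qed.

Lemma const_frac_mxM A B :
  const_frac_mx (A *m B) = const_frac_mx A *m const_frac_mx B.
Proof.
apply/matrixP=> i j; rewrite !mxE !rmorph_sum /=; apply: eq_bigr => k _.
by rewrite !mxE polyCM tofracM.
Qed.

Lemma const_frac_mx1 : const_frac_mx 1 = 1%:M.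
Proof.
apply/matrixP=> i j; rewrite !mxE.
by case: (i == j); rewrite ?polyC1 ?tofrac1 ?polyC0 ?tofrac0.
Qed.

(** By Cramer's rule the entry is a cofactor of [char_poly_mx A] over [char_poly A], whose size is
    [n.+1]; the cofactor has degree at most [n.-1]. *)
Lemma resolvent_strictly_proper A i j :
  strictly_proper (resolvent A i j).
Proof.
rewrite unlock /invmx pencil_unit det_map_mx -map_mx_adj !mxE mulrC.
exists (cofactor (char_poly_mx A) j i), (char_poly A); split => //.
rewrite size_char_poly ltnS /cofactor size_Msign.
set D := \det _; suff leD : (size D <= n.-1.+1)%N.
  (* The index [i] witnesses [0 < n], so that [n.-1.+1] is [n]. *)
  by apply: leq_trans leD _; rewrite prednK // (leq_ltn_trans _ (ltn_ord i)).
rewrite /D /determinant; apply: (leq_trans (size_sum _ _ _)).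
apply/bigmax_leqP=> s _; rewrite size_Msign.
apply: leq_trans (size_poly_prod_leq _ _) _.
(* Each of the [n.-1] factors has size at most 2, so it suffices to bound the sum of the sizes by
   [n.-1 * 2]. *)
rewrite card_ord leq_subLR addnS ltnS addnn -muln2.
rewrite -[X in (_ <= X * 2)%N]card_ord -sum_nat_const.
apply: leq_sum => k _.
rewrite !mxE; apply: leq_trans (size_polyD _ _) _.
rewrite size_polyN geq_max (leq_trans (size_polyC_leq1 _)) // andbT.
by case: (_ == _); rewrite ?mulr1n ?mulr0n ?size_polyX ?size_poly0.
Qed.

Lemma const_mul_resolvent_strictly_proper A B i j :
  strictly_proper ((const_frac_mx B *m resolvent A) i j).
Proof.
rewrite mxE; apply: strictly_proper_sum => k; rewrite mxE.
exact: strictly_properZ (resolvent_strictly_proper _ _ _).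
Qed.

(** This is [pencil A *m resolvent A = 1] multiplied on the left by [A ^+ k]. *)
Lemma resolvent_shift A k i j :
  'X%:F * (const_frac_mx (A ^+ k) *m resolvent A) i j =
  ((A ^+ k) i j)%:P%:F
  + (const_frac_mx (A ^+ k.+1) *m resolvent A) i j.
Proof.
have /(congr1 (mulmx (const_frac_mx (A ^+ k)))) := pencil_mul_resolvent A.
rewrite {1}pencilE mulmxBl mul_scalar_mx mulmxBr mulmx1 -scalemxAr mulmxA.
rewrite -const_frac_mxM.
have -> : A ^+ k *m A = A ^+ k.+1 by rewrite exprSr.
move/eqP; rewrite subr_eq => /eqP/matrixP/(_ i j).
by rewrite [LHS]mxE [RHS]mxE [const_frac_mx _ i j]mxE.
Qed.

(* The Markov parameters are the coefficients of the expansion of the resolvent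
   at infinity; they are split off one at a time, as the polynomial part of
   ['X] times a strictly proper fraction. *)
Lemma resolvent_markov A B i j :
  resolvent A i j = resolvent B i j ->
  forall k, (A ^+ k) i j = (B ^+ k) i j.
Proof.
move=> EAB.
(* The two shift identities share their left-hand side, so the difference of the constants is a
   difference of strictly proper fractions, hence zero. *)
have step k : (const_frac_mx (A ^+ k) *m resolvent A) i j =
              (const_frac_mx (B ^+ k) *m resolvent B) i j ->
    (A ^+ k) i j = (B ^+ k) i j.
  move=> Ek; apply/eqP; rewrite -subr_eq0; apply/eqP.
  apply: strictly_proper_const; rewrite polyCB tofracB.
  have := resolvent_shift A k i j; rewrite Ek resolvent_shift => /eqP.
  rewrite eq_sym -subr_eq => /eqP <-.
  rewrite -addrA opprD addNKr opprB; apply: strictly_properD.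
    exact: const_mul_resolvent_strictly_proper.
  exact: strictly_properN (const_mul_resolvent_strictly_proper _ _ _ _).
suff E k : (const_frac_mx (A ^+ k) *m resolvent A) i j =
           (const_frac_mx (B ^+ k) *m resolvent B) i j.
  by move=> k; apply: step.
elim: k => [|k IHk].
  by rewrite !expr0 const_frac_mx1 !mul1mx.
have := resolvent_shift A k i j; rewrite IHk resolvent_shift (step k IHk).
by move/addrI.
Qed.

End MarkovParameters.

Lemma trmxX (K : comNzRingType) (n k : nat) (A : 'M[K]_n) :
  (A ^+ k)^T = A^T ^+ k.
Proof.
elim: k => [|k IHk]; first by rewrite !expr0 trmx1.
by rewrite exprS exprSr -IHk; apply: trmx_mul.
Qed.

(** * Propagation of the Markov parameters along color changes *)

Section Forcing.
Context {R : realType} {n : nat}.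
Implicit Types (e : rel 'I_n) (X Y : 'M[R]_n) (B : {set 'I_n}) (u v w : 'I_n).

(** Quantifying over every power makes the invariant inductive: power [k] at a forced vertex is
    computed from higher powers on [B]. *)
Definition same_markov X Y B : Prop :=
  forall a b, a \in B -> b \in B -> forall k, (X ^+ k) a b = (Y ^+ k) a b.

(** Expand [X *m X ^+ k] along row [u]: outside [B] only the column [v] contributes. The diagonal
    entry [X u u], whose sign is arbitrary, falls into the sum over [B]. *)
Lemma forced_row e X B u v :
  Qp e X -> u \in B -> [set w | e u w & w \notin B] = [set v] ->
  0 < X u v /\ forall k w,
  X u v * (X ^+ k) v w =
  (X ^+ k.+1) u w - \sum_(j in B) X u j * (X ^+ k) j w.
Proof.
move=> [symX entX] uB Ev.
have /andP[euv vB] : e u v && (v \notin B).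
  by have /setP/(_ v) := Ev; rewrite !inE eqxx.
have symXE a b : X a b = X b a by rewrite -{1}symX mxE.
have neq_u a : a \notin B -> u != a.
  by apply: contraNneq => <-.
split; first by rewrite symXE; apply: (entX u v (neq_u _ vB)).1.
move=> k w; apply/eqP; rewrite eq_sym subr_eq; apply/eqP.
have -> : (X ^+ k.+1) u w = \sum_j X u j * (X ^+ k) j w.
  by rewrite exprS [LHS]mxE.
rewrite (bigID (mem B)) /= addrC; congr (_ + _).
rewrite (bigD1 v) //= big1 ?addr0 // => j /andP[jB jv].
rewrite symXE (entX u j (neq_u _ jB)).2 ?mul0r //.
by have /setP/(_ j) := Ev; rewrite !inE (negPf jv) jB andbT => ->.
Qed.

Lemma color_change_same_markov e X Y B B' :
  Qp e X -> Qp e Y -> color_change e B B' ->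
  same_markov X Y B -> same_markov X Y B'.
Proof.
move=> QX QY /exists_inP[u uB /existsP[v /andP[/eqP Ev /eqP->]]] EB.
have [X_gt0 rowX] := forced_row QX uB Ev.
have [Y_gt0 rowY] := forced_row QY uB Ev.
have symE (Z : 'M[R]_n) : Qp e Z -> forall k a b, (Z ^+ k) a b = (Z ^+ k) b a.
  by case=> symZ _ k a b; rewrite -{1}symZ -trmxX mxE.
have entry a b : a \in B -> b \in B -> X a b = Y a b.
  by move=> aB bB; have := EB a b aB bB 1%N; rewrite !expr1.
(* The assumption bears on column [w] over the rows in [B], instead of on [w \in B], so that [w = v]
   is allowed later. *)
have row_v w k : (forall j k, j \in B -> (X ^+ k) j w = (Y ^+ k) j w) ->
    X u v * (X ^+ k) v w = Y u v * (Y ^+ k) v w.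
  move=> Ew; rewrite rowX rowY Ew //; congr (_ - _).
  by apply: eq_bigr => j jB; rewrite entry // Ew.
have Euv : X u v = Y u v.
  have := row_v u 1%N (fun j k jB => EB j u jB uB k).
  rewrite symE // [in RHS]symE // !expr1 -!expr2 => /eqP.
  by rewrite eqrXn2 ?ltW // => /eqP.
have cancel_v w k : (forall j k, j \in B -> (X ^+ k) j w = (Y ^+ k) j w) ->
    (X ^+ k) v w = (Y ^+ k) v w.
  by move=> /row_v - /(_ k); rewrite Euv; apply: mulfI; rewrite gt_eqF.
have Evw w k : w \in B -> (X ^+ k) v w = (Y ^+ k) v w.
  by move=> wB; apply: cancel_v => j l jB; apply: EB.
have Ewv w k : w \in B -> (X ^+ k) w v = (Y ^+ k) w v.
  by move=> wB; rewrite symE // Evw // symE.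
move=> a b; rewrite !in_setU1.
move=> /predU1P[->|aB] /predU1P[->|bB] k; [|exact: Evw|exact: Ewv|exact: EB].
(* The entry at [(v, v)] comes last, once column [v] is known on [B]. *)
by apply: cancel_v => j l; apply: Ewv.
Qed.

Lemma connect_same_markov e X Y B B' :
  Qp e X -> Qp e Y -> connect (color_change e) B B' ->
  same_markov X Y B -> same_markov X Y B'.
Proof.
move=> QX QY /connectP[p]; elim: p B => [|A p IHp] B /=; first by move=> _ ->.
case/andP=> BA pA lastA EB; apply: IHp pA lastA _.
exact: color_change_same_markov BA EB.
Qed.

(** Each product with a selection matrix reduces to a single term. The memberships [aO] and [bI]
    make the ranks of [a] and [b] available as indices. *)
Lemma transfer_matrix_entry (VI VO : {set 'I_n}) X (a b : 'I_n)
    (aO : a \in VO) (bI : b \in VI) :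
  transfer_matrix VI VO X (enum_rank_in aO a) (enum_rank_in bI b) =
  resolvent (map_mx (real_complex R) X) a b.
Proof.
have -> : resolvent (map_mx (real_complex R) X) = invmx (resolvent_pencil X).
  by rewrite unlock; congr invmx; rewrite pencilE /const_frac_mx -map_mx_comp.
rewrite /transfer_matrix mxE (bigD1 b) //= big1 ?addr0 => [|j jb]; last first.
  by rewrite [X in _ * X]mxE enum_rankK_in // (negPf jb) mulr0.
rewrite [X in _ * X]mxE enum_rankK_in // eqxx mulr1.
rewrite mxE (bigD1 a) //= big1 ?addr0 => [|j ja]; last first.
  by rewrite !mxE enum_rankK_in // (negPf ja) mul0r.
by rewrite !mxE enum_rankK_in // eqxx mul1r.
Qed.

Lemma transfer_matrix_same_markov (VI VO : {set 'I_n}) X Y :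
  transfer_matrix VI VO X = transfer_matrix VI VO Y ->
  same_markov X Y (VI :&: VO).
Proof.
move=> E a b /setIP[_ aO] /setIP[bI _] k.
have Eab := congr1 (fun T : 'M_(_, _) =>
  T (enum_rank_in aO a) (enum_rank_in bI b)) E.
have /resolvent_markov/(_ k) := etrans
  (esym (transfer_matrix_entry X aO bI))
  (etrans Eab (transfer_matrix_entry Y aO bI)).
(* Equality of the powers over [R[i]] descends to [R] by injectivity of the embedding. *)
by rewrite -!rmorphXn !mxE => /complexI.
Qed.

End Forcing.

Theorem theorem3 (R : realType) (n : nat) (e : rel 'I_n)
    (VI VO : {set 'I_n}) :
  simple_graph e ->
  zero_forcing e (VI :&: VO) ->
  identifiable R e VI VO.
Proof.
move=> _ [forceV _] X Y QX QY /transfer_matrix_same_markov EB.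
have EV := connect_same_markov QX QY forceV EB.
apply/matrixP=> i j.
by have := EV i j (in_setT i) (in_setT j) 1%N; rewrite !expr1.
Qed.
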